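(* Let $k$ be a field and let $\mathfrak{h}$ be a Leibniz algebra over $k$. Then the current Leibniz algebra functor $\mathfrak{h} \otimes - : \mathrm{ComAlg}_k \to \mathrm{Lbz}_k$ has a left adjoint if and only if $\mathfrak{h}$ is finite dimensional over $k$. Moreover, if $\mathfrak{h} \neq 0$, then the functor $\mathfrak{h} \otimes -$ does not admit a right adjoint.
   Context: All vector spaces, algebras and tensor products are over an arbitrary field $k$. A Leibniz algebra is a vector space $\mathfrak{h}$ with a bilinear map $[-,-]:\mathfrak{h}\times\mathfrak{h}\to\mathfrak{h}$ satisfying $[x,[y,z]] = [[x,y],z]-[[x,z],y]$ for all $x,y,z\in\mathfrak{h}$; homomorphisms of Leibniz algebras are bracket-preserving linear maps. $\mathrm{Lbz}_k$ is the category of Leibniz algebras and $\mathrm{ComAlg}_k$ is the category of commutative associative unital $k$-algebras with unital algebra homomorphisms. For a Leibniz algebra $\mathfrak{h}$ and a commutative algebra $A$, the current Leibniz algebra $\mathfrak{h}\otimes A$ is the vector space $\mathfrak{h}\otimes A$ with bracket determined by $[x\otimes a, y\otimes b] := [x,y]\otimes ab$. The functor $\mathfrak{h}\otimes -$ sends $A$ to $\mathfrak{h}\otimes A$ and an algebra map $f:A\to B$ to $\mathrm{Id}_{\mathfrak{h}}\otimes f$. *)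

(* Defs.v *)
From HB Require Import structures.
From mathcomp Require Import all_boot all_algebra.
From mathcomp Require Import boolp freeg.

Set Implicit Arguments.
Unset Strict Implicit.
Unset Printing Implicit Defensive.

Import GRing.Theory.
Local Open Scope ring_scope.
Local Open Scope quotient_scope.

Local Notation bilinear f := (bilinear_for *:%R *:%R f).

Record category := Category {
  obj :> Type;
  hom : obj -> obj -> Type;
  idm : forall x, hom x x;
  comp : forall x y z, hom y z -> hom x y -> hom x z;
  comp1m : forall x y (f : hom x y), comp (idm y) f = f;
  compm1 : forall x y (f : hom x y), comp f (idm x) = f;
  compmA : forall x y z t (f : hom z t) (g : hom y z) (e : hom x y),
    comp f (comp g e) = comp (comp f g) e
}.
Arguments hom {c} x y.
Arguments idm {c} x.
Arguments comp {c x y z} f g.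

Record functor (C D : category) := Functor {
  fobj :> C -> D;
  fmap : forall x y, hom x y -> hom (fobj x) (fobj y);
  fmap1 : forall x, fmap (idm x) = idm (fobj x);
  fmap_comp : forall x y z (f : hom y z) (g : hom x y),
    fmap (comp f g) = comp (fmap f) (fmap g)
}.
Arguments fmap {C D} F {x y} f : rename.

Definition adjoint (C D : category) (L : functor C D) (R : functor D C) : Prop :=
  exists phi : forall (x : C) (y : D), hom (L x) y -> hom x (R y),
    (forall x y, bijective (phi x y)) /\
    (forall x x' y y' (f : hom x' x) (g : hom y y') (u : hom (L x) y),
      phi x' y' (comp g (comp u (fmap L f)))
        = comp (fmap R g) (comp (phi x y u) f)).

Definition has_left_adjoint (C D : category) (F : functor C D) : Prop :=
  exists L : functor D C, adjoint L F.

Definition has_right_adjoint (C D : category) (F : functor C D) : Prop :=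
  exists R : functor D C, adjoint F R.

Lemma linear_eq (k : fieldType) (U V : lmodType k) (f g : {linear U -> V}) :
  f =1 g -> f = g.
Proof.
case: f g => [f [[fa] [fz]]] [g [[ga] [gz]]] /= /funext fg.
rewrite {}fg in fa fz *.
by rewrite (Prop_irrelevance fa ga) (Prop_irrelevance fz gz).
Qed.

(* The algebra structures of ssralg (lalgType, algType, comAlgType) require   *)
(* 1 != 0; here the zero algebra is an object of the category.                *)
Record comPzAlg (k : fieldType) := ComPzAlg {
  alg_ring : comPzRingType;
  alg_scale : k -> alg_ring -> alg_ring;
  alg_scaleA : forall c d a, alg_scale c (alg_scale d a) = alg_scale (c * d) a;
  alg_scale1 : left_id 1 alg_scale;
  alg_scaleDr : right_distributive alg_scale +%R;
  alg_scaleDl : forall a, {morph alg_scale^~ a : c d / c + d};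
  alg_scaleAl : forall c a b, alg_scale c (a * b) = alg_scale c a * b
}.

Definition alg_sort (k : fieldType) (A : comPzAlg k) : Type := alg_ring A.
Coercion alg_sort : comPzAlg >-> Sortclass.
HB.instance Definition _ (k : fieldType) (A : comPzAlg k) :=
  GRing.ComPzRing.on (alg_sort A).
HB.instance Definition _ (k : fieldType) (A : comPzAlg k) :=
  GRing.Zmodule_isLmodule.Build k (alg_sort A)
    (@alg_scaleA k A) (@alg_scale1 k A) (@alg_scaleDr k A) (@alg_scaleDl k A).

Record algHom (k : fieldType) (A B : comPzAlg k) := AlgHom {
  algHom_linear :> {linear A -> B};
  algHomP : monoid_morphism algHom_linear
}.

Section ComAlgCategory.
Variable k : fieldType.
Implicit Types A B C : comPzAlg k.

Lemma algHom_eq A B (f g : algHom A B) : f =1 g -> f = g.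
Proof.
case: f g => [f fP] [g gP] /= /linear_eq fg.
by rewrite fg in fP *; rewrite (Prop_irrelevance fP gP).
Qed.

Definition algHom_id A : algHom A A.
Proof. by exists (idfun : {linear A -> A}). Defined.

Definition algHom_comp A B C (f : algHom B C) (g : algHom A B) : algHom A C.
Proof.
exists (f \o g : {linear A -> C}).
by split=> [|a b] /=; rewrite (algHomP g) (algHomP f).
Defined.

Definition comAlg : category.
Proof.
exists (comPzAlg k) (@algHom k) algHom_id algHom_comp.
- by move=> A B f; apply: algHom_eq.
- by move=> A B f; apply: algHom_eq.
- by move=> A B C D f g e; apply: algHom_eq.
Defined.

End ComAlgCategory.

HB.mixin Record isLeibniz (k : fieldType) h of GRing.Lmodule k h := {
  lbr : h -> h -> h;
  lbr_bilinear : bilinear lbr;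
  lbrA : forall x y z, lbr x (lbr y z) = lbr (lbr x y) z - lbr (lbr x z) y
}.

#[short(type="leibnizType")]
HB.structure Definition Leibniz (k : fieldType) :=
  {h of isLeibniz k h & GRing.Lmodule k h}.

Record lbzHom (k : fieldType) (g h : leibnizType k) := LbzHom {
  lbzHom_linear :> {linear g -> h};
  lbzHomP : {morph lbzHom_linear : x y / lbr x y}
}.

Section LbzCategory.
Variable k : fieldType.
Implicit Types g h l : leibnizType k.

Lemma lbzHom_eq g h (e f : lbzHom g h) : e =1 f -> e = f.
Proof.
case: e f => [e eP] [f fP] /= /linear_eq ef.
by rewrite ef in eP *; rewrite (Prop_irrelevance eP fP).
Qed.

Definition lbzHom_id g : lbzHom g g.
Proof. by exists (idfun : {linear g -> g}). Defined.

Definition lbzHom_comp g h l (e : lbzHom h l) (f : lbzHom g h) : lbzHom g l.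
Proof.
exists (e \o f : {linear g -> l}).
by move=> x y /=; rewrite (lbzHomP f) (lbzHomP e).
Defined.

Definition lbz : category.
Proof.
exists (leibnizType k) (@lbzHom k) lbzHom_id lbzHom_comp.
- by move=> g h f; apply: lbzHom_eq.
- by move=> g h f; apply: lbzHom_eq.
- by move=> g h l m f e d; apply: lbzHom_eq.
Defined.

End LbzCategory.

Section Tensor.
Variables (k : fieldType) (U V : lmodType k).
Local Notation free := {freeg (U * V)%type / k}.
Local Notation gen x v := (Freeg [:: (1, (x, v))] : free).

(* Kernel of the projection from the free vector space on U * V onto the      *)
(* tensor product.                                                            *)
Inductive bilin_rel : free -> Prop :=
| bilin_rel0 : bilin_rel 0
| bilin_relP a s t : bilin_rel s -> bilin_rel t -> bilin_rel (a *: s + t)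
| bilin_relL a x y v : bilin_rel (gen (a *: x + y) v - (a *: gen x v + gen y v))
| bilin_relR a x u v : bilin_rel (gen x (a *: u + v) - (a *: gen x u + gen x v)).

Definition bilin_pred : {pred free} := fun s => `[< bilin_rel s >].

Fact bilin_pred_submod : submod_closed bilin_pred.
Proof.
split=> [|a s t /asboolP rs /asboolP rt]; apply/asboolP.
- exact: bilin_rel0.
- exact: bilin_relP.
Qed.
HB.instance Definition _ :=
  GRing.isSubmodClosed.Build k free bilin_pred bilin_pred_submod.

Definition tensor := Quotient.quot bilin_pred.
HB.instance Definition _ := GRing.Zmodule.on tensor.

Definition tensor_pi (s : free) : tensor := \pi_tensor s.
Definition tensor_scale (a : k) (t : tensor) : tensor :=
  tensor_pi (a *: repr t).

Fact tensor_piP s t : (tensor_pi s = tensor_pi t) <-> bilin_rel (s - t).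
Proof.
split=> [/eqP|st].
- by rewrite /tensor_pi -Quotient.idealrBE => /asboolP.
- by apply/eqP; rewrite /tensor_pi -Quotient.idealrBE; apply/asboolP.
Qed.

Fact tensor_piK t : tensor_pi (repr t) = t. Proof. exact: reprK. Qed.

Fact tensor_pi_zmod : zmod_morphism tensor_pi.
Proof. by move=> s t; rewrite /tensor_pi !piE. Qed.

Fact tensor_piZ a s : tensor_pi (a *: s) = tensor_scale a (tensor_pi s).
Proof.
apply/tensor_piP; rewrite -scalerBr -[_ *: _]addr0.
apply: bilin_relP; last exact: bilin_rel0.
by apply/tensor_piP; rewrite tensor_piK.
Qed.

HB.instance Definition _ :=
  GRing.isZmodMorphism.Build free tensor tensor_pi tensor_pi_zmod.

Fact tensor_scaleA a b t :
  tensor_scale a (tensor_scale b t) = tensor_scale (a * b) t.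
Proof. by rewrite -[t]tensor_piK -!tensor_piZ scalerA. Qed.
Fact tensor_scale1 : left_id 1 tensor_scale.
Proof. by move=> t; rewrite -[t]tensor_piK -!tensor_piZ scale1r. Qed.
Fact tensor_scaleDr : right_distributive tensor_scale +%R.
Proof.
move=> a s t; rewrite -[s]tensor_piK -[t]tensor_piK.
by rewrite -raddfD -!tensor_piZ scalerDr raddfD.
Qed.
Fact tensor_scaleDl t : {morph tensor_scale^~ t : a b / a + b}.
Proof.
by move=> a b; rewrite -[t]tensor_piK -!tensor_piZ scalerDl raddfD.
Qed.
HB.instance Definition _ := GRing.Zmodule_isLmodule.Build k tensor
  tensor_scaleA tensor_scale1 tensor_scaleDr tensor_scaleDl.

HB.instance Definition _ :=
  GRing.isScalable.Build k free tensor *:%R tensor_pi tensor_piZ.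

Definition tens (x : U) (v : V) : tensor := tensor_pi (gen x v).

Lemma tens_bilinear : bilinear tens.
Proof.
by split=> [v a x y|x a u v] /=; rewrite -linearP; apply/tensor_piP;
  constructor.
Qed.

Lemma tensor_ind (P : tensor -> Prop) :
  P 0 -> (forall a x v t, P t -> P (a *: tens x v + t)) -> forall t, P t.
Proof.
move=> P0 PD t; rewrite -[t]tensor_piK; elim/freeg_ind_dom0: (repr t).
  by rewrite raddf0.
move=> a [x v] s _ _ IH.
rewrite raddfD /=; suff -> : tensor_pi << a *g (x, v) >> = a *: tens x v.
  exact: PD.
rewrite -linearZ /=; congr tensor_pi; apply/eqP/freeg_eqP => z.
by rewrite coeffZ !coeffU mul1r.
Qed.

Section Lift.
Variables (W : lmodType k) (f : U -> V -> W).

Definition tensor_lift (t : tensor) : W :=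
  fglift (fun xv => f xv.1 xv.2) (repr t).

Hypothesis f_bilinear : bilinear f.

Let lift := fglift (fun xv : U * V => f xv.1 xv.2).
Let liftB : zmod_morphism lift. Proof. exact: lift_is_additive. Qed.
HB.instance Definition _ := GRing.isZmodMorphism.Build free W lift liftB.

Let lift_gen x v : lift (gen x v) = f x v.
Proof. by rewrite /lift liftU scale1r. Qed.

Let liftZ : scalable lift.
Proof.
move=> a s; elim/freeg_ind_dom0: s => [|c xv s _ _ IH].
  by rewrite scaler0 raddf0 scaler0.
rewrite scalerDr !raddfD /= IH; congr (_ + _).
suff -> : a *: << c *g xv >> = << a * c *g xv >> :> free.
  by rewrite /lift !liftU scalerA.
by apply/eqP/freeg_eqP => z; rewrite coeffZ !coeffU mulrA.
Qed.

Let lift_rel s : bilin_rel s -> lift s = 0.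
Proof.
elim=> [|a {}s t _ IHs _ IHt|a x y v|a x u v].
- exact: raddf0.
- by rewrite raddfD /= liftZ IHs IHt scaler0 addr0.
- by rewrite raddfB raddfD /= liftZ !lift_gen f_bilinear subrr.
- by rewrite raddfB raddfD /= liftZ !lift_gen f_bilinear subrr.
Qed.

Let tensor_lift_pi s : tensor_lift (tensor_pi s) = lift s.
Proof.
apply/eqP; rewrite -subr_eq0; apply/eqP.
rewrite -[tensor_lift _]/(lift _) -raddfB; apply: lift_rel.
by apply/tensor_piP; rewrite tensor_piK.
Qed.

Lemma tensor_lift_linear : linear tensor_lift.
Proof.
move=> a s t; rewrite -[s]tensor_piK -[t]tensor_piK -linearZ -raddfD /=.
by rewrite !tensor_lift_pi raddfD /= liftZ.
Qed.

Lemma tensor_liftE x v : tensor_lift (tens x v) = f x v.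
Proof. by rewrite tensor_lift_pi lift_gen. Qed.

End Lift.

Lemma tensor_linear_eq (W : lmodType k) (f g : tensor -> W) :
  linear f -> linear g -> (forall x v, f (tens x v) = g (tens x v)) -> f =1 g.
Proof.
move=> lf lg fg; elim/tensor_ind => [|a x v t IH]; last by rewrite lf lg fg IH.
have lin0 (e : tensor -> W) : linear e -> e 0 = 0.
  by move=> le; have := le (-1) 0 0; rewrite scaler0 addr0 scaleN1r addNr.
by rewrite !lin0.
Qed.

End Tensor.

Arguments tens {k U V} x v.

Lemma linear_comb (k : fieldType) (U V : lmodType k) c (f g : U -> V) :
  linear f -> linear g -> linear (fun u => c *: f u + g u).
Proof.
move=> lf lg a s t /=; rewrite lf lg !scalerDr !scalerA addrACA.
by rewrite [a * c]mulrC.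
Qed.

Lemma alg_bilinear (k : fieldType) (A : comPzAlg k) :
  bilinear (fun a b : A => a * b).
Proof.
have scaleAl c (a b : A) : c *: (a * b) = (c *: a) * b by exact: alg_scaleAl.
split=> [b c a d|a c b d] /=; first by rewrite mulrDl scaleAl.
by rewrite mulrDr [a * (c *: b)]mulrC -scaleAl [b * a]mulrC.
Qed.

Section CurrentBracket.
Variables (k : fieldType) (h : leibnizType k) (A : comPzAlg k).
Implicit Types (x y z : h) (a b c : A) (s t u : tensor h A).

Let br1 x a t : tensor h A :=
  tensor_lift (fun (y : h) (b : A) => tens (lbr x y) (a * b)) t.

Definition current_br s t : tensor h A :=
  tensor_lift (fun (x : h) (a : A) =>
    tensor_lift (fun (y : h) (b : A) => tens (lbr x y) (a * b)) t) s.

Let br0_bilinear x a :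
  bilinear (fun (y : h) (b : A) => tens (lbr x y) (a * b)).
Proof.
split=> [b e y z|y e b c] /=.
  by rewrite lbr_bilinear tens_bilinear.
by rewrite alg_bilinear tens_bilinear.
Qed.

Let br1_linear x a : linear (br1 x a).
Proof. exact: tensor_lift_linear. Qed.

Let br1E x a y b : br1 x a (tens y b) = tens (lbr x y) (a * b).
Proof. exact: tensor_liftE. Qed.

Let br1_bilinear t : bilinear (fun x a => br1 x a t).
Proof.
split=> [a e x y|x e a b] /=.
- apply: (tensor_linear_eq (f := br1 (e *: x + y) a)
    (g := fun t => e *: br1 x a t + br1 y a t)) => [||z c] //.
    exact: linear_comb.
  by rewrite !br1E lbr_bilinear tens_bilinear.
- apply: (tensor_linear_eq (f := br1 x (e *: a + b))
    (g := fun t => e *: br1 x a t + br1 x b t)) => [||z c] //.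
    exact: linear_comb.
  by rewrite !br1E (alg_bilinear A).1 tens_bilinear.
Qed.

Let current_br_linearl t : linear (current_br^~ t).
Proof. exact/tensor_lift_linear/br1_bilinear. Qed.

Let current_br_tensl x a t : current_br (tens x a) t = br1 x a t.
Proof. exact: (tensor_liftE (br1_bilinear t)). Qed.

Let current_br_linearr s : linear (current_br s).
Proof.
move=> e t u; apply: (tensor_linear_eq (f := current_br^~ (e *: t + u))
  (g := fun s => e *: current_br s t + current_br s u)) => [||x a] //.
  exact: linear_comb.
by rewrite !current_br_tensl br1_linear.
Qed.

Lemma current_br_bilinear : bilinear current_br.
Proof. by split. Qed.

Lemma current_brE x a y b :
  current_br (tens x a) (tens y b) = tens (lbr x y) (a * b).
Proof. by rewrite current_br_tensl br1E. Qed.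

Lemma current_brA s t u :
  current_br s (current_br t u)
    = current_br (current_br s t) u - current_br (current_br s u) t.
Proof.
have linB (U V : lmodType k) (f g : U -> V) :
    linear f -> linear g -> linear (fun v => f v - g v).
  by move=> lf lg e v w /=; rewrite lf lg opprD scalerBr addrACA.
apply: (tensor_linear_eq (f := current_br^~ (current_br t u))
  (g := fun s => current_br (current_br s t) u - current_br (current_br s u) t))
  => [||x a] //.
  by apply: linB => e v w /=; rewrite !current_br_linearl.
apply: (tensor_linear_eq (f := fun t => current_br (tens x a) (current_br t u))
  (g := fun t => current_br (current_br (tens x a) t) u
                 - current_br (current_br (tens x a) u) t)) => [||y b].
- by move=> e v w /=; rewrite current_br_linearl current_br_linearr.
- by apply: linB => // e v w /=; rewrite current_br_linearr current_br_linearl.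
apply: (tensor_linear_eq
  (f := fun u => current_br (tens x a) (current_br (tens y b) u))
  (g := fun u => current_br (current_br (tens x a) (tens y b)) u
    - current_br (current_br (tens x a) u) (tens y b))) => [||z c].
- by move=> e v w /=; rewrite !current_br_linearr.
- by apply: linB => // e v w /=; rewrite current_br_linearr current_br_linearl.
rewrite !current_brE lbrA [a * c * b]mulrAC mulrA.
by rewrite -!scaleN1r ![_ + -1 *: _]addrC tens_bilinear.
Qed.

HB.instance Definition _ :=
  isLeibniz.Build k (tensor h A) current_br_bilinear current_brA.

End CurrentBracket.

Section CurrentFunctor.
Variables (k : fieldType) (h : leibnizType k).

Section Map.
Variables (A B : comPzAlg k) (f : algHom A B).

Definition current_map_fun : tensor h A -> tensor h B :=
  tensor_lift (fun (x : h) (a : A) => tens x (f a)).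

Let current_map_bilinear : bilinear (fun (x : h) (a : A) => tens x (f a)).
Proof.
split=> [a e x y|x e a b] /=; first by rewrite tens_bilinear.
by rewrite linearP tens_bilinear.
Qed.

Fact current_map_linear : linear current_map_fun.
Proof. exact: tensor_lift_linear. Qed.
HB.instance Definition _ := GRing.isLinear.Build k (tensor h A) (tensor h B)
  *:%R current_map_fun current_map_linear.

Lemma current_mapE x a : current_map_fun (tens x a) = tens x (f a).
Proof. exact: (tensor_liftE current_map_bilinear). Qed.

Fact current_map_lbr : {morph current_map_fun : s t / lbr s t}.
Proof.
move=> s t; apply: (tensor_linear_eq (f := fun s => current_map_fun (lbr s t))
  (g := fun s => lbr (current_map_fun s) (current_map_fun t))) => [||x a].
- by move=> e u v; rewrite lbr_bilinear linearP.
- by move=> e u v; rewrite linearP lbr_bilinear.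
apply: (tensor_linear_eq (f := fun t => current_map_fun (lbr (tens x a) t))
  (g := fun t => lbr (current_map_fun (tens x a)) (current_map_fun t)))
  => [||y b].
- by move=> e u v; rewrite lbr_bilinear linearP.
- by move=> e u v; rewrite linearP lbr_bilinear.
rewrite !current_mapE -[lbr _ _]/(current_br _ _) current_brE current_mapE.
by rewrite -[RHS]/(current_br _ _) current_brE (algHomP f).
Qed.

Definition current_map : lbzHom (tensor h A) (tensor h B) :=
  LbzHom (lbzHom_linear := current_map_fun) current_map_lbr.

End Map.

Definition current : functor (comAlg k) (lbz k).
Proof.
exists (fun A : comAlg k => tensor h (A : comPzAlg k) : leibnizType k) current_map.
- move=> A; apply: lbzHom_eq; apply: tensor_linear_eq => [||x a].
  + exact: linearP.
  + by [].
  + exact: current_mapE.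
- move=> A B C f g; apply: lbzHom_eq; apply: tensor_linear_eq => [||x a].
  + exact: linearP.
  + exact: linearP.
  + by rewrite /= !current_mapE.
Defined.

End CurrentFunctor.

Definition finite_dimensional (k : fieldType) (V : lmodType k) : Prop :=
  exists n, inhabited (Vector.axiom n V).

(* Main.v *)
(* If [h] has a finite spanning family [e] with coordinate forms [c], a       *)
(* homomorphism [g -> h (x) A] is the family of its coordinates in [A], so    *)
(* the algebra generated by symbols [X_(x,i)], [x] in [g], subject to all the *)
(* identities that such coordinates satisfy in every [A], is a universal      *)
(* arrow.  Conversely, if [L] is a left adjoint, every homomorphism from the  *)
(* abelian Leibniz algebra [k] to [h (x) A] factors through the unit [k -> h  *)
(* (x) L(k)], which sends [1] to a finite sum of [e_i (x) c_i].  Over the     *)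
(* dual numbers [x (x) eps] has zero square for every [x] in [h], hence every *)
(* [x] lies in the span of the [e_i].  Finally, a functor with a right        *)
(* adjoint preserves initial objects, whereas [k] is initial and [h (x) k]    *)
(* has two endomorphisms, identity and zero, if [h != 0].                     *)

Require Import Defs.
From HB Require Import structures.
From mathcomp Require Import all_boot all_algebra.
From mathcomp Require Import boolp.
(* [hom] and [comp] are shadowed by [vector] and [ssrfun]. *)
Import Defs.

Set Implicit Arguments.
Unset Strict Implicit.
Unset Printing Implicit Defensive.

Import GRing.Theory.

Local Open Scope ring_scope.
Local Open Scope quotient_scope.

(** A left adjoint amounts to a universal arrow [g -> h (x) P] for each [g]
    ([universal_arrows_left_adjoint]). When [h] has finite coordinates, a tensor over [A] is
    recovered from finitely many elements of [A] ([contractl_sum]), naturally in [A]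
    ([contractl_map]); the algebra [pres_alg] generated by formal coordinates is then universal
    ([pres_hom_unit], [pres_hom_unique]). Conversely, a universal arrow out of a line has as its
    value at 1 one finite sum of pure tensors, whose [h]-components must span [h], as dual numbers
    detect ([left_adjoint_finite_dimensional]). The last claim rests on [scalar_algHom_eq]: the
    scalars admit at most one map to any algebra. *)

Lemma universal_arrows_left_adjoint (C D : category) (F : functor C D) :
    (forall d : D, exists (c : C) (eta : hom d (F c)),
      forall (c' : C) (u : hom d (F c')),
        exists! f : hom c c', comp (fmap F f) eta = u) ->
  has_left_adjoint F.
Proof.
move=> univ.
pose L d : C := projT1 (cid (univ d)).
pose eta d : hom d (F (L d)) := projT1 (cid (projT2 (cid (univ d)))).
have etaP d c (u : hom d (F c)) :
    exists! f : hom (L d) c, comp (fmap F f) (eta d) = u.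
  exact: (projT2 (cid (projT2 (cid (univ d))))).
pose ext d c (u : hom d (F c)) : hom (L d) c := projT1 (cid (etaP d c u)).
have extK d c (u : hom d (F c)) : comp (fmap F (ext d c u)) (eta d) = u.
  by case: (projT2 (cid (etaP d c u))).
have extU d c (f : hom (L d) c) : ext d c (comp (fmap F f) (eta d)) = f.
  by case: (projT2 (cid (etaP d c (comp (fmap F f) (eta d))))) => _; apply.
pose Lmap d d' (w : hom d d') : hom (L d) (L d') := ext _ _ (comp (eta d') w).
have Lmap1 d : Lmap d d (idm d) = idm (L d).
  by rewrite -[RHS]extU fmap1 comp1m /Lmap compm1.
have LmapM d d' d'' (w : hom d' d'') (v : hom d d') :
    Lmap _ _ (comp w v) = comp (Lmap _ _ w) (Lmap _ _ v).
  by rewrite -[RHS]extU fmap_comp -compmA extK compmA extK -compmA.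
exists (Functor Lmap1 LmapM), (fun d c f => comp (fmap F f) (eta d)).
split=> [d c|d d' c c' w g f] /=; first by exists (ext d c) => // u.
by rewrite !fmap_comp -!compmA extK.
Qed.

Section FiniteDimension.
Variables (k : fieldType) (V : lmodType k).

(** A spanning family of minimal size is free, hence a basis, and its coordinates identify [V] with
    row vectors. *)
Lemma spanning_finite_dimensional n (e : 'I_n -> V) :
    (forall x, exists a : 'I_n -> k, x = \sum_i a i *: e i) ->
  finite_dimensional V.
Proof.
pose spans m (e : 'I_m -> V) :=
  forall x, exists a : 'I_m -> k, x = \sum_i a i *: e i.
move=> e_spans; pose P m := `[< exists e, @spans m e >].
have exP : exists m, P m by exists n; apply/asboolP; exists e.
case: (ex_minnP exP) => m /asboolP[b b_spans] m_min {n e e_spans exP}.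
have b_free (a : 'I_m -> k) : \sum_i a i *: b i = 0 -> forall i, a i = 0.
  move=> ab0 j; apply/eqP/negPn/negP => aj0.
  case: m b b_spans m_min a ab0 j aj0 => [|m] b b_spans m_min a ab0 j aj0.
    by case: j aj0.
  suff /m_min : P m by rewrite ltnn.
  apply/asboolP; exists (fun i => b (lift j i)) => x.
  have [d ->] := b_spans x.
  exists (fun i => d (lift j i) - d j / a j * a (lift j i)).
  rewrite (bigD1_ord j) //=.
  have -> : b j = - \sum_i ((a j)^-1 * a (lift j i)) *: b (lift j i).
    move/eqP: ab0; rewrite (bigD1_ord j) //= addr_eq0 => /eqP abj.
    rewrite -[b j]scale1r -(mulVf aj0) -scalerA abj scalerN; congr (- _).
    by rewrite scaler_sumr; apply: eq_bigr => i _; rewrite scalerA.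
  rewrite scalerN scaler_sumr addrC -sumrB; apply: eq_bigr => i _.
  by rewrite scalerA scalerBl mulrA.
pose comb (v : 'rV[k]_m) := \sum_i v 0 i *: b i.
have comb_linear : linear comb.
  move=> a u v; rewrite /comb scaler_sumr -big_split /=; apply: eq_bigr => i _.
  by rewrite !mxE scalerDl scalerA.
have comb_inj u v : comb u = comb v -> u = v.
  move=> /eqP; rewrite -subr_eq0 /comb -sumrB => /eqP uv0.
  apply/rowP => i; apply/eqP; rewrite -subr_eq0; apply/eqP.
  move: i; apply: b_free; rewrite -[RHS]uv0; apply: eq_bigr => i _.
  by rewrite scalerBl.
have comb_surj x : exists v, comb v = x.
  have [a ->] := b_spans x; exists (\row_i a i).
  by apply: eq_bigr => i _; rewrite mxE.
pose crd x := projT1 (cid (comb_surj x)).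
have crdK : cancel crd comb by move=> x; apply: (projT2 (cid (comb_surj x))).
have combK : cancel comb crd by move=> v; apply: comb_inj; rewrite crdK.
exists m; constructor; exists crd; last by exists comb.
by move=> a x y; apply: comb_inj; rewrite comb_linear !crdK.
Qed.

Lemma finite_dimensional_coords : finite_dimensional V ->
  exists n (e : 'I_n -> V) (c : 'I_n -> {scalar V}),
    forall x, x = \sum_i c i x *: e i.
Proof.
move=> [n [[v2r v2r_linear [r2v v2rK r2vK]]]].
have c_linear i : linear_for *%R (fun x => v2r x 0 i).
  by move=> a x y; rewrite v2r_linear !mxE.
pose c i : {scalar V} := HB.pack (fun x => v2r x 0 i)
  (GRing.isLinear.Build k V k *%R _ (c_linear i)).
exists n, (fun i => r2v (delta_mx 0 i)), c => x.
pose f : {linear V -> 'rV[k]_n} := HB.pack v2r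
  (GRing.isLinear.Build k V 'rV[k]_n *:%R _ v2r_linear).
apply: (can_inj v2rK); rewrite -[v2r]/(f : _ -> _) linear_sum.
rewrite [LHS]row_sum_delta; apply: eq_bigr => i _.
by rewrite linearZ /= r2vK.
Qed.

End FiniteDimension.

(** * Contracting tensors with linear forms *)

Section Contraction.
Variables (k : fieldType) (U V : lmodType k).

Definition contractl (c : {scalar U}) : tensor U V -> V :=
  tensor_lift (fun x v => c x *: v).

Definition contractr (c : {scalar V}) : tensor U V -> U :=
  tensor_lift (fun x v => c v *: x).

Lemma contractl_bilinear (c : {scalar U}) :
  bilinear_for *:%R *:%R (fun x (v : V) => c x *: v).
Proof.
split=> [v a x y|x a u v] /=; first by rewrite linearP scalerDl scalerA.
by rewrite scalerDr !scalerA mulrC.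
Qed.

Lemma contractr_bilinear (c : {scalar V}) :
  bilinear_for *:%R *:%R (fun (x : U) v => c v *: x).
Proof.
split=> [v a x y|x a u v] /=; last by rewrite linearP scalerDl scalerA.
by rewrite scalerDr !scalerA mulrC.
Qed.

Lemma contractl_linear c : linear (contractl c).
Proof. exact/tensor_lift_linear/contractl_bilinear. Qed.
HB.instance Definition _ c := GRing.isLinear.Build k (tensor U V) V *:%R
  (contractl c) (contractl_linear c).

Lemma contractr_linear c : linear (contractr c).
Proof. exact/tensor_lift_linear/contractr_bilinear. Qed.
HB.instance Definition _ c := GRing.isLinear.Build k (tensor U V) U *:%R
  (contractr c) (contractr_linear c).

Lemma contractlE c x v : contractl c (tens x v) = c x *: v.
Proof. exact: (tensor_liftE (contractl_bilinear c)). Qed.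

Lemma contractrE c x v : contractr c (tens x v) = c v *: x.
Proof. exact: (tensor_liftE (contractr_bilinear c)). Qed.

Lemma tens_is_linear x : linear (@tens k U V x).
Proof. by move=> a u v; rewrite tens_bilinear. Qed.
HB.instance Definition _ x := GRing.isLinear.Build k V (tensor U V) *:%R
  (@tens k U V x) (tens_is_linear x).

Lemma tens_suml (I : finType) (a : I -> k) (e : I -> U) (v : V) :
  tens (\sum_i a i *: e i) v = \sum_i tens (e i) (a i *: v).
Proof.
pose f : {linear U -> tensor U V} := HB.pack (fun x : U => tens x v)
  (GRing.isLinear.Build k U (tensor U V) *:%R (fun x : U => tens x v)
     ((tens_bilinear U V).1 v)).
rewrite -[LHS]/(f _) linear_sum; apply: eq_bigr => i _.
by rewrite !linearZ.
Qed.

Lemma tensor_sum_tens (t : tensor U V) :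
  exists n (e : 'I_n -> U) (v : 'I_n -> V), t = \sum_i tens (e i) (v i).
Proof.
elim/tensor_ind: t => [|a x v t [n [e [w ->]]]].
  by exists 0, (fun=> 0), (fun=> 0); rewrite big_ord0.
exists n.+1, (fun i => oapp e x (unlift ord0 i)).
exists (fun i => oapp w (a *: v) (unlift ord0 i)).
rewrite big_ord_recl unlift_none /= linearZ; congr (_ + _).
by apply: eq_bigr => i _; rewrite liftK.
Qed.

Lemma contractl_sum n (e : 'I_n -> U) (c : 'I_n -> {scalar U}) :
    (forall x, x = \sum_i c i x *: e i) ->
  forall t : tensor U V, t = \sum_i tens (e i) (contractl (c i) t).
Proof.
move=> ec; apply: tensor_linear_eq => [a s t //|a s t|x v].
- rewrite scaler_sumr -big_split; apply: eq_bigr => i _ /=.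
  by rewrite !linearP.
- rewrite [in LHS](ec x) tens_suml; apply: eq_bigr => i _.
  by rewrite contractlE.
Qed.

End Contraction.

Lemma contractl_map (k : fieldType) (h : leibnizType k) (A B : comPzAlg k)
    (f : algHom A B) (c : {scalar h}) (t : tensor h A) :
  contractl c (current_map h f t) = f (contractl c t).
Proof.
move: t; apply: tensor_linear_eq => [a s t|a s t|x v]; rewrite ?linearP //.
by rewrite /= current_mapE !contractlE linearZ.
Qed.

(** * The algebra representing homomorphisms into current algebras *)

Section Presentation.
Variables (k : fieldType) (h g : leibnizType k) (n : nat).
Variables (e : 'I_n -> h) (c : 'I_n -> {scalar h}).
Hypothesis ec : forall x, x = \sum_i c i x *: e i.
Implicit Types A B : comPzAlg k.

(** [Gen x i] is the formal [i]-th coordinate of the image of [x] under an unspecified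
    homomorphism. *)
Inductive term :=
| Gen of g & 'I_n
| Cst of k
| Opp of term
| Add of term & term
| Mul of term & term.

HB.instance Definition _ := gen_eqMixin term.
HB.instance Definition _ := gen_choiceMixin term.

Fixpoint eval (A : comPzAlg k) (u : lbzHom g (tensor h A)) (t : term) : A :=
  match t with
  | Gen x i => contractl (c i) (u x)
  | Cst a => a *: (1 : A)
  | Opp s => - eval u s
  | Add s t => eval u s + eval u t
  | Mul s t => eval u s * eval u t
  end.

(* Quantifying over all [A] and [u] makes every identity of commutative       *)
(* algebras, and every relation expressing that [u] is a homomorphism, hold   *)
(* in the quotient by construction; as [Prop] is impredicative, the quotient  *)
(* is again a small algebra.                                                  *)
Definition eval_eq (s t : term) : bool :=
  `[< forall (A : comPzAlg k) (u : lbzHom g (tensor h A)),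
        eval u s = eval u t >].

Fact eval_eq_equiv : equiv_class_of eval_eq.
Proof.
split=> [t|s t|t s r].
- exact/asboolP.
- by apply/asboolP/asboolP => st A u; rewrite st.
- by move=> /asboolP st /asboolP tr; apply/asboolP => A u; rewrite st.
Qed.
Canonical eval_eq_equivRel := EquivRelPack eval_eq_equiv.

Definition pres := {eq_quot eval_eq}.
HB.instance Definition _ := Choice.on pres.
Definition cls (t : term) : pres := \pi_pres t.

Definition pres_eval A (u : lbzHom g (tensor h A)) (p : pres) : A :=
  eval u (repr p).

Lemma pres_eval_cls A (u : lbzHom g (tensor h A)) t :
  pres_eval u (cls t) = eval u t.
Proof.
have /eqquotP/asboolP : repr (cls t) = t %[mod pres] by rewrite reprK.
exact.
Qed.

(** Evaluations separate points, so each algebra law of [pres] reduces to the same law in [A]. *)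
Lemma pres_eval_inj (p q : pres) :
    (forall A (u : lbzHom g (tensor h A)), pres_eval u p = pres_eval u q) ->
  p = q.
Proof.
by move=> pq; rewrite -[p]reprK -[q]reprK; apply/eqquotP/asboolP.
Qed.

Definition pres_cst a : pres := cls (Cst a).
Definition pres_opp (p : pres) : pres := cls (Opp (repr p)).
Definition pres_add (p q : pres) : pres := cls (Add (repr p) (repr q)).
Definition pres_mul (p q : pres) : pres := cls (Mul (repr p) (repr q)).
Definition pres_scale a p : pres := pres_mul (pres_cst a) p.

Lemma pres_evalC A (u : lbzHom g (tensor h A)) a :
  pres_eval u (pres_cst a) = a *: (1 : A).
Proof. exact: pres_eval_cls. Qed.
Lemma pres_evalN A (u : lbzHom g (tensor h A)) p :
  pres_eval u (pres_opp p) = - pres_eval u p.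
Proof. exact: pres_eval_cls. Qed.
Lemma pres_evalD A (u : lbzHom g (tensor h A)) p q :
  pres_eval u (pres_add p q) = pres_eval u p + pres_eval u q.
Proof. exact: pres_eval_cls. Qed.
Lemma pres_evalM A (u : lbzHom g (tensor h A)) p q :
  pres_eval u (pres_mul p q) = pres_eval u p * pres_eval u q.
Proof. exact: pres_eval_cls. Qed.
Lemma pres_evalZ A (u : lbzHom g (tensor h A)) a p :
  pres_eval u (pres_scale a p) = a *: pres_eval u p.
Proof.
rewrite pres_evalM pres_evalC.
by rewrite -[RHS]/(alg_scale a _) -[X in alg_scale a X]mul1r alg_scaleAl.
Qed.

Let evalE := (pres_evalZ, pres_evalC, pres_evalN, pres_evalD, pres_evalM).

Fact pres_addA : associative pres_add.
Proof. by move=> p q r; apply: pres_eval_inj => A u; rewrite !evalE addrA. Qed.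
Fact pres_addC : commutative pres_add.
Proof. by move=> p q; apply: pres_eval_inj => A u; rewrite !evalE addrC. Qed.
Fact pres_add0 : left_id (pres_cst 0) pres_add.
Proof.
by move=> p; apply: pres_eval_inj => A u; rewrite !evalE scale0r add0r.
Qed.
Fact pres_addN : left_inverse (pres_cst 0) pres_opp pres_add.
Proof.
by move=> p; apply: pres_eval_inj => A u; rewrite !evalE scale0r addNr.
Qed.
HB.instance Definition _ :=
  GRing.isZmodule.Build pres pres_addA pres_addC pres_add0 pres_addN.

Fact pres_mulA : associative pres_mul.
Proof. by move=> p q r; apply: pres_eval_inj => A u; rewrite !evalE mulrA. Qed.
Fact pres_mulC : commutative pres_mul.
Proof. by move=> p q; apply: pres_eval_inj => A u; rewrite !evalE mulrC. Qed.
Fact pres_mul1 : left_id (pres_cst 1) pres_mul.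
Proof.
by move=> p; apply: pres_eval_inj => A u; rewrite !evalE scale1r mul1r.
Qed.
Fact pres_mulDl : left_distributive pres_mul +%R.
Proof.
by move=> p q r; apply: pres_eval_inj => A u; rewrite !evalE mulrDl.
Qed.
HB.instance Definition _ := GRing.Zmodule_isComPzRing.Build pres
  pres_mulA pres_mulC pres_mul1 pres_mulDl.

Fact pres_scaleA a b p :
  pres_scale a (pres_scale b p) = pres_scale (a * b) p.
Proof. by apply: pres_eval_inj => A u; rewrite !evalE scalerA. Qed.
Fact pres_scale1 : left_id 1 pres_scale.
Proof. exact: mul1r. Qed.
Fact pres_scaleDr : right_distributive pres_scale +%R.
Proof. by move=> a p q; apply: mulrDr. Qed.
Fact pres_scaleDl p : {morph pres_scale^~ p : a b / a + b}.
Proof.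
by move=> a b; apply: pres_eval_inj => A u; rewrite !evalE scalerDl.
Qed.
Fact pres_scaleAl a p q : pres_scale a (p * q) = pres_scale a p * q.
Proof. exact: mulrA. Qed.

Definition pres_alg : comPzAlg k := @ComPzAlg k pres pres_scale
  pres_scaleA pres_scale1 pres_scaleDr pres_scaleDl pres_scaleAl.

Section Eval.
Variables (A : comPzAlg k) (u : lbzHom g (tensor h A)).

Fact pres_eval_linear : linear (pres_eval u : pres_alg -> A).
Proof. by move=> a p q; rewrite pres_evalD pres_evalZ. Qed.
HB.instance Definition _ := GRing.isLinear.Build k pres_alg A *:%R
  (pres_eval u : pres_alg -> A) pres_eval_linear.

Fact pres_eval_monoid : monoid_morphism (pres_eval u : pres_alg -> A).
Proof. by split=> [|p q]; rewrite ?pres_evalM // pres_evalC scale1r. Qed.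

Definition pres_hom : algHom pres_alg A :=
  AlgHom (algHom_linear := pres_eval u : pres_alg -> A) pres_eval_monoid.

End Eval.

Definition pres_unit_fun (x : g) : tensor h pres_alg :=
  \sum_i tens (e i) (cls (Gen x i) : pres_alg).

Lemma pres_hom_unit A (u : lbzHom g (tensor h A)) x :
  current_map h (pres_hom u) (pres_unit_fun x) = u x.
Proof.
rewrite [RHS](contractl_sum ec) linear_sum; apply: eq_bigr => i _.
by rewrite /= current_mapE /= pres_eval_cls.
Qed.

(** Separation of points passes to tensors coordinate by coordinate. It makes [pres_unit_fun] a
    homomorphism, because every composite with an evaluation is one. *)
Lemma tensor_pres_eq (s t : tensor h pres_alg) :
    (forall A (u : lbzHom g (tensor h A)),
      current_map h (pres_hom u) s = current_map h (pres_hom u) t) ->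
  s = t.
Proof.
move=> st; rewrite (contractl_sum ec s) (contractl_sum ec t).
apply: eq_bigr => i _; congr tens; apply: pres_eval_inj => A u.
by rewrite -[LHS](contractl_map (pres_hom u)) st contractl_map.
Qed.

Fact pres_unit_linear : linear pres_unit_fun.
Proof.
move=> a x y; apply: tensor_pres_eq => A u.
by rewrite linearP !pres_hom_unit linearP.
Qed.
HB.instance Definition _ := GRing.isLinear.Build k g (tensor h pres_alg) *:%R
  pres_unit_fun pres_unit_linear.

Fact pres_unit_lbr : {morph pres_unit_fun : x y / lbr x y}.
Proof.
move=> x y; apply: tensor_pres_eq => A u.
by rewrite lbzHomP !pres_hom_unit lbzHomP.
Qed.

Definition pres_unit : lbzHom g (tensor h pres_alg) :=
  LbzHom (lbzHom_linear := pres_unit_fun) pres_unit_lbr.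

(** The family [e] only spans, so [c i (e j)] need not be a Kronecker delta; the identity holds
    because it does after every evaluation. *)
Lemma contractl_pres_unit x i : contractl (c i) (pres_unit x) = cls (Gen x i).
Proof.
apply: pres_eval_inj => A u.
by rewrite -[LHS](contractl_map (pres_hom u)) pres_hom_unit pres_eval_cls.
Qed.

Lemma pres_hom_unique A (f : algHom pres_alg A) (u : lbzHom g (tensor h A)) :
    (forall x, current_map h f (pres_unit x) = u x) -> pres_hom u = f.
Proof.
move=> fu; apply: algHom_eq => p; rewrite -[p]reprK.
rewrite [LHS]pres_eval_cls.
have [f1 fM] := algHomP f.
elim: (repr p) => [x i|a|s IH|s IHs t IHt|s IHs t IHt] /=.
- by rewrite -fu contractl_map contractl_pres_unit.
(* From here on, the class of a compound term is the operation applied to the classes of its parts,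
   both having the same evaluations. *)
- rewrite -f1 -linearZ; congr (f _); apply: pres_eval_inj => B w.
  by rewrite pres_evalZ !pres_eval_cls /= scale1r.
- rewrite IH -linearN; congr (f _); apply: pres_eval_inj => B w.
  by rewrite pres_evalN !pres_eval_cls.
- rewrite IHs IHt -linearD; congr (f _); apply: pres_eval_inj => B w.
  by rewrite pres_evalD !pres_eval_cls.
- rewrite IHs IHt -fM; congr (f _); apply: pres_eval_inj => B w.
  by rewrite pres_evalM !pres_eval_cls.
Qed.

End Presentation.

Lemma finite_dimensional_left_adjoint (k : fieldType) (h : leibnizType k) :
  finite_dimensional h -> has_left_adjoint (current h).
Proof.
move=> /finite_dimensional_coords[n [e [c ec]]].
apply: universal_arrows_left_adjoint => g.
exists (pres_alg g c), (pres_unit g ec) => A u.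
exists (pres_hom c u); split.
  by apply: lbzHom_eq => x; apply: pres_hom_unit.
by move=> f <-; apply: (pres_hom_unique (ec := ec)).
Qed.

(** * Test objects and the necessity of finite dimension *)

Section Abelian.
Variables (k : fieldType) (V : lmodType k).

Definition abelian : Type := V.
HB.instance Definition _ := GRing.Lmodule.on abelian.

Definition abelian_br (x y : abelian) : abelian := 0.

Fact abelian_br_bilinear : bilinear_for *:%R *:%R abelian_br.
Proof. by split=> [x a y z|x a y z]; rewrite /= scaler0 addr0. Qed.
Fact abelian_brA x y z : abelian_br x (abelian_br y z)
  = abelian_br (abelian_br x y) z - abelian_br (abelian_br x z) y.
Proof. by rewrite subr0. Qed.
HB.instance Definition _ :=
  isLeibniz.Build k abelian abelian_br_bilinear abelian_brA.

End Abelian.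

Section DualNumbers.
Variable k : fieldType.

(** The pair [(a, b)] stands for [a + b eps] with [eps] of square zero. *)
Definition dual : Type := (k * k)%type.
HB.instance Definition _ := GRing.Zmodule.on dual.

Definition dual_mul (p q : dual) : dual := (p.1 * q.1, p.1 * q.2 + p.2 * q.1).

Fact dual_mulA : associative dual_mul.
Proof.
by move=> p q r; congr pair; rewrite /= ?mulrA // mulrDr mulrDl !mulrA addrA.
Qed.
Fact dual_mulC : commutative dual_mul.
Proof.
move=> p q; congr pair; first exact: mulrC.
by rewrite addrC [p.2 * _]mulrC [p.1 * _]mulrC.
Qed.
Fact dual_mul1 : left_id (1, 0) dual_mul.
Proof. by move=> [a b]; congr pair; rewrite /= ?mul0r ?addr0 mul1r. Qed.
Fact dual_mulDl : left_distributive dual_mul +%R.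
Proof. by move=> p q r; congr pair; rewrite /= !mulrDl // addrACA. Qed.
HB.instance Definition _ := GRing.Zmodule_isComPzRing.Build dual
  dual_mulA dual_mulC dual_mul1 dual_mulDl.

Definition dual_scale (a : k) (p : dual) : dual := (a * p.1, a * p.2).

Definition dual_alg : comPzAlg k.
Proof.
exists dual dual_scale.
- by move=> a b p; rewrite /dual_scale !mulrA.
- by move=> [a b]; rewrite /dual_scale !mul1r.
- by move=> a p q; rewrite /dual_scale !mulrDr.
- by move=> p a b; rewrite /dual_scale !mulrDl.
- by move=> a p q; congr pair; rewrite /= ?mulrDr !mulrA.
Defined.

Definition dual_eps : dual_alg := (0, 1).

Lemma dual_eps_sqr : dual_eps * dual_eps = 0.
Proof. by congr pair; rewrite /= !mul0r ?mulr0 ?addr0. Qed.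

Definition dual_snd (p : dual_alg) : k := p.2.
Fact dual_snd_linear : linear_for *%R dual_snd. Proof. by []. Qed.
HB.instance Definition _ := GRing.isLinear.Build k dual_alg k *%R
  dual_snd dual_snd_linear.

End DualNumbers.

Section BracketTheory.
Variables (k : fieldType) (g : leibnizType k).
Implicit Types (a : k) (x y : g).

Lemma lbrZl a x y : lbr (a *: x) y = a *: lbr x y.
Proof.
have Dl := (lbr_bilinear (s := g)).1 y; rewrite /= in Dl.
have lbr0 : lbr 0 y = 0.
  by have := Dl (-1) 0 0; rewrite scaler0 addr0 scaleN1r addNr.
by have := Dl a x 0; rewrite lbr0 !addr0.
Qed.

Lemma lbrZr a x y : lbr x (a *: y) = a *: lbr x y.
Proof.
have Dr := (lbr_bilinear (s := g)).2 x; rewrite /= in Dr.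
have lbr0 : lbr x 0 = 0.
  by have := Dr (-1) 0 0; rewrite scaler0 addr0 scaleN1r addNr.
by have := Dr a y 0; rewrite lbr0 !addr0.
Qed.

End BracketTheory.

Section SquareZero.
Variables (k : fieldType) (g : leibnizType k) (s : g).
Hypothesis ss0 : lbr s s = 0.

Definition line_fun (a : abelian k^o) : g := (a : k) *: s.
Fact line_linear : linear line_fun.
Proof. by move=> a x y; rewrite /line_fun scalerDl scalerA. Qed.
HB.instance Definition _ := GRing.isLinear.Build k (abelian k^o) g *:%R
  line_fun line_linear.
Fact line_lbr : {morph line_fun : x y / lbr x y}.
Proof.
by move=> a b; rewrite /line_fun lbrZl lbrZr ss0 !scaler0 scale0r.
Qed.
Definition line : lbzHom (abelian k^o) g :=
  LbzHom (lbzHom_linear := line_fun) line_lbr.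
End SquareZero.

Lemma left_adjoint_finite_dimensional (k : fieldType) (h : leibnizType k) :
  has_left_adjoint (current h) -> finite_dimensional h.
Proof.
move=> [L [phi [phi_bij phi_nat]]].
pose g : leibnizType k := abelian k^o.
pose eta : lbzHom g (tensor h (L g)) := phi g (L g) (idm (L g)).
(* The [e i] are fixed before [x] is introduced, so one finite family serves all of [h]. *)
have [n [e [c etaE]]] := tensor_sum_tens (eta 1).
apply: (@spanning_finite_dimensional _ _ n e) => x.
pose s : tensor h (dual_alg k) := tens x (dual_eps k).
have ss0 : lbr s s = 0.
  by rewrite -[LHS]/(current_br s s) current_brE dual_eps_sqr linear0.
have [psi _ psiK] := phi_bij g (dual_alg k : comAlg k).
pose f : algHom (L g) (dual_alg k) := psi (line ss0).
have fE : lbzHom_comp (current_map h f) eta = line ss0.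
  have := phi_nat _ _ _ _ (idm (g : lbz k)) f (idm (L g)).
  by rewrite fmap1 !compm1 psiK => /esym.
have sE : s = current_map h f (eta 1).
  have := congr1 (fun u : lbzHom g _ => u (1 : k^o)) fE.
  by rewrite /= /line_fun scale1r => <-.
(* Applying the [eps]-coordinate to both sides of [sE] turns [x (x) eps] into [x] and the image of
   [eta 1] into a combination of the [e i]. *)
exists (fun i => dual_snd (f (c i))).
have := congr1 (contractr (@dual_snd k)) sE.
rewrite contractrE scale1r => ->; rewrite etaE !linear_sum.
by apply: eq_bigr => i _; rewrite /= current_mapE contractrE.
Qed.

(** * Scalars and the absence of a right adjoint *)

Section Scalars.
Variable k : fieldType.
Definition scalar_alg : comPzAlg k.
Proof.
exists k *%R; [exact: mulrA|exact: mul1r|exact: mulrDr| |exact: mulrA].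
by move=> c a b; apply: mulrDl.
Defined.

Lemma scalar_algHom_eq (A : comPzAlg k) (f g : algHom scalar_alg A) : f = g.
Proof.
apply: algHom_eq => a; rewrite -[a]mulr1 -[_ * _]/(a *: (1 : scalar_alg)).
by rewrite !linearZ /= (algHomP f).1 (algHomP g).1.
Qed.
End Scalars.

Lemma no_right_adjoint (k : fieldType) (h : leibnizType k) (x : h) :
  x != 0 -> ~ has_right_adjoint (current h).
Proof.
move=> /eqP x0 [R [phi [phi_bij _]]]; apply: x0.
pose hk : leibnizType k := tensor h (scalar_alg k).
have zero_lbr : {morph (\0 : {linear hk -> hk}) : s t / lbr s t}.
  move=> s t; have lbr00 : lbr (0 : hk) 0 = 0.
    by rewrite -{1}(scale0r (0 : hk)) lbrZl scale0r.
  by rewrite -[RHS]/(lbr (0 : hk) 0) lbr00.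
pose z : lbzHom hk hk := LbzHom zero_lbr.
have idz : lbzHom_id hk = z.
  have phi_inj := bij_inj (phi_bij (scalar_alg k : comAlg k) hk).
  (* Identity and zero are both sent into the algebra maps from [k] to [R hk], of which there is at
     most one. *)
  by apply: phi_inj; apply: scalar_algHom_eq.
have id_linear : linear_for *%R (fun a : scalar_alg k => a : k) by [].
pose f : {scalar scalar_alg k} := HB.pack (fun a : scalar_alg k => a : k)
  (GRing.isLinear.Build k (scalar_alg k) k *%R _ id_linear).
(* Contraction recovers [x] from [x (x) 1], which vanishes once the identity is zero. *)
rewrite -[x]scale1r -[LHS](contractrE f x (1 : scalar_alg k)).
by rewrite -[tens x _]/(lbzHom_id hk (tens x _)) idz linear0.
Qed.

Theorem theorem2p1 (k : fieldType) (h : leibnizType k) :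
  (has_left_adjoint (current h) <-> finite_dimensional h)
  /\ ((exists x : h, x != 0) -> ~ has_right_adjoint (current h)).
Proof.
split; last by move=> [x]; apply: no_right_adjoint.
split; first exact: left_adjoint_finite_dimensional.
exact: finite_dimensional_left_adjoint.
Qed.
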